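(* Let $p\in(1,\infty)$ and, for each $m\in\mathbb{N}$, let $\varphi_m^D$ be the Daubechies orthonormal scaling function of order $m$, i.e. $\widehat{\varphi_m^D}(\omega)=\frac{1}{\sqrt{2\pi}}\prod_{\ell=1}^\infty H_m(2^{-\ell}\omega)$. Then for every $k\in\mathbb{N}$, $$\lim_{m\to\infty}\|\widehat{{}_{-k}\varphi_m^D}\|_p=\pi^k\,\frac{(2\pi)^{1/p-1/2}}{(1+pk)^{1/p}}.$$
   Context: The Fourier transform is $\widehat f(\omega)=\frac{1}{\sqrt{2\pi}}\int_{\mathbb{R}}f(x)e^{-i x\omega}\,dx$; $\|\cdot\|_p$ is the $L_p(\mathbb{R})$ norm. For an integer $k$, ${}_kf$ denotes the function with $\widehat{{}_kf}(\omega)=(i\omega)^{-k}\widehat f(\omega)$; thus $\widehat{{}_{-k}f}(\omega)=(i\omega)^{k}\widehat f(\omega)$. $H_m$ is the Daubechies orthonormal low-pass mask of order $m$: a $2\pi$-periodic trigonometric polynomial $H_m(t)=\sum_{\nu=0}^L h_\nu e^{-i\nu t}$ with $$|H_m(t)|^2=1-c_m\int_0^t\sin^{2m-1}\omega\,d\omega,\qquad c_m=\left(\int_0^\pi\sin^{2m-1}\omega\,d\omega\right)^{-1}$$ (equivalently $|H_m(t)|^2=\cos^{2m}(t/2)\sum_{\nu=0}^{m-1}\binom{m-1+\nu}{\nu}\sin^{2\nu}(t/2)$), normalized by $H_m(0)=1$ so that the infinite product converges. *)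

(* Defs.v *)
From HB Require Import structures.
From mathcomp Require Import all_boot all_order all_algebra.
From mathcomp Require Import complex.
From mathcomp Require Import all_classical all_reals all_analysis.
Set Implicit Arguments.
Unset Strict Implicit.
Unset Printing Implicit Defensive.
Import Order.TTheory GRing.Theory Num.Theory.
Import numFieldNormedType.Exports.

Local Open Scope classical_set_scope.
Local Open Scope ring_scope.
Local Open Scope complex_scope.

Section ComplexAnalysis.
Variable R : realType.
Implicit Types (f g : R -> R[i]) (a b w x t p : R).
Local Notation mu := (@lebesgue_measure R).

Definition expi x : R[i] := cos x +i* sin x.

Definition cintegrable f : Prop :=
  mu.-integrable setT (EFin \o (fun x => complex.Re (f x))) /\
  mu.-integrable setT (EFin \o (fun x => complex.Im (f x))).

Definition cintegral f : R[i] :=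
  Rintegral mu setT (fun x => complex.Re (f x)) +i*
  Rintegral mu setT (fun x => complex.Im (f x)).

(* \int_a^b u with the usual sign convention when b < a. *)
Definition oriented_integral (u : R -> R) a b : R :=
  if a <= b then Rintegral mu `[a, b] u else - Rintegral mu `[b, a] u.

(* Extended-real valued, so it is defined (possibly +oo) for every f. *)
Definition Lp_norm p f : \bar R :=
  Lnorm mu p%:E (fun x => (Normc.normc (f x))%:E).

Definition fourier f w : R[i] :=
  ((Num.sqrt (2 * pi))^-1)%:C * cintegral (fun x => f x * expi (- (x * w))).

(* The Fourier transform of _k f, that is (i w)^(- k) times that of f. The
   function _k f is specified only through this transform (for k < 0 it need
   not exist as an integrable function), so no function _k f is introduced. *)
Definition fourier_shifted (k : int) f w : R[i] :=
  ('i * w%:C) ^ (- k) * fourier f w.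

(* R[i]^o carries the topology of the modulus. *)
Definition infinite_product (u : nat -> R[i]) : R[i] :=
  limn (fun n => (\prod_(1 <= l < n.+1) u l : R[i]^o)).

End ComplexAnalysis.

Section Daubechies.
Variable R : realType.
Implicit Types (H phi : R -> R[i]) (m : nat).

Definition trig_poly H : Prop :=
  exists (L : nat) (h : nat -> R[i]), forall t : R,
    H t = \sum_(0 <= nu < L.+1) h nu * expi (- (nu%:R * t)).

Definition daubechies_const m : R :=
  (oriented_integral (fun w : R => sin w ^+ (2 * m - 1)%N) 0 pi)^-1.

(* Meaningful for 0 < m: the exponent 2 m - 1 is a truncated subtraction. *)
Definition daubechies_mask m H : Prop :=
  [/\ trig_poly H,
      forall t : R, Normc.normc (H t) ^+ 2 =
        1 - daubechies_const m *
            oriented_integral (fun w : R => sin w ^+ (2 * m - 1)%N) 0 t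
    & H 0 = 1].

Definition scaling_function H phi : Prop :=
  cintegrable phi /\
  forall w : R, fourier phi w =
    ((Num.sqrt (2 * pi))^-1)%:C *
    infinite_product (fun l => H (2 ^- l * w)).

(* The mask is determined by its modulus only up to the choice of a spectral
   factor; every choice is allowed. *)
Definition daubechies_scaling_function m phi : Prop :=
  exists H, daubechies_mask m H /\ scaling_function H phi.

End Daubechies.

(* Main.v *)
Require Import Defs.
From HB Require Import structures.
From mathcomp Require Import all_boot all_order all_algebra.
From mathcomp Require Import complex polyrcf ring lra.
From mathcomp Require Import all_classical all_reals all_analysis.
From mathcomp Require Import measurable_realfun.
Set Implicit Arguments.
Unset Strict Implicit.
Unset Printing Implicit Defensive.
Import Order.TTheory GRing.Theory Num.Theory.
Import numFieldNormedType.Exports.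
Local Open Scope classical_set_scope.
Local Open Scope ring_scope.

(* Put x = cos t.  The squared modulus of the mask is the polynomial
   B(x) = 1 - N(x) / N(-1), where N' = - (1 - x^2)^(m-1) and N(1) = 0.
   Comparing N with N(0) (1 - x^2)^m on [0, 1] gives 1 - B <= (1 - x^2)^m for
   x >= 0 and B <= (1 - x^2)^m for x <= 0, so on [-pi, pi] the modulus of
   the mask tends to the indicator function of |t| < pi / 2, and that of the
   infinite product to the indicator function of |w| < pi.

   It remains to dominate uniformly in m.  With y = sin^2 (t / 2) the bounds say
   B <= ((1 - y) max(2, 4 y))^m.  Along the doubling orbit y' = 4 y (1 - y) the
   factors 1 - y telescope to order 4^-J, while max(2, 4 y) contributes at most
   3 per step on average; so if 2^-J |w| lies in (pi / 2, pi], the squared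
   product is at most (8/3 (3/4)^J)^m.  For m large this decays faster than any
   fixed power of |w|, and dominated convergence applies. *)

(** * Primitives of polynomials *)

Lemma poly_primitive (R : numFieldType) (p : {poly R}) :
  exists q : {poly R}, q^`() = p.
Proof.
exists (\poly_(i < (size p).+1) (p`_i.-1 / i%:R)).
apply/polyP => i; rewrite coef_deriv coef_poly ltnS /=.
case: ltnP => [ip|pi]; last by rewrite mul0rn nth_default.
by rewrite -[LHS]mulr_natr divfK // pnatr_eq0.
Qed.

Lemma deriv_eq0_horner (R : rcfType) (p : {poly R}) (x y : R) :
  p^`() = 0 -> p.[x] = p.[y].
Proof.
move=> p0; wlog xy : x y / x < y => [wl|].
  by have [/wl //|/wl //|->] := ltgtP x y.
have [c _ /eqP] := poly_mvt p xy.
by rewrite p0 horner0 mul0r subr_eq0 => /eqP.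
Qed.

(** * The integral of [sin ^+ (2 n + 1)] as a polynomial [N] in the cosine *)

Section DaubechiesPolynomial.
Variables (R : rcfType) (n : nat) (N : {poly R}).
Hypothesis dN : N^`() = - (1 - 'X^2) ^+ n.
Hypothesis N1 : N.[1] = 0.

Let dNE x : N^`().[x] = - (1 - x ^+ 2) ^+ n.
Proof. by rewrite dN hornerN horner_exp !hornerE. Qed.

(** The derivative of [N] is even, so the left side has derivative 0 and keeps its value at 0. *)
Lemma tail_reflection (x : R) : N.[x] + N.[- x] = 2 * N.[0].
Proof.
have -> : 2 * N.[0] = (N + (N \Po (- 'X))).[0].
  by rewrite hornerD horner_comp hornerN hornerX oppr0 mulr_natl mulr2n.
rewrite (_ : N.[x] + N.[- x] = (N + (N \Po (- 'X))).[x]); last first.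
  by rewrite hornerD horner_comp hornerN hornerX.
apply: deriv_eq0_horner; rewrite derivD deriv_comp derivN derivX dN.
by rewrite rmorphN rmorphXn rmorphB rmorph1 rmorphXn /= comp_polyX sqrrN mulrN1 opprK addNr.
Qed.

Lemma tail_antitone (x y : R) : -1 <= x -> x <= y -> y <= 1 -> N.[y] <= N.[x].
Proof.
move=> x1 xy y1; rewrite -lerN2 -!hornerN.
apply: (@ler_hornerW _ (-1) 1); rewrite ?in_itv /= ?x1 ?y1 ?(le_trans x1) ?(le_trans xy) //.
move=> c; rewrite in_itv /= derivN hornerN dNE opprK => /andP[c0 c1].
by apply: exprn_ge0; nra.
Qed.

Lemma tail_gt0 : 0 < N.[0].
Proof.
have [c + /eqP] := poly_mvt N (@ltr01 R).
rewrite in_itv /= N1 sub0r dNE subr0 mulr1 eqr_opp => /andP[c0 c1] /eqP ->.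
by apply: exprn_gt0; nra.
Qed.

(* The derivative of the difference of both sides is [(1 - X^2)^n] times the
   decreasing affine function [1 - 2 (n + 1) N(0) X], and the difference
   vanishes at both end points of [0, 1]. *)
Lemma tail_le (x : R) : 0 <= x <= 1 -> N.[x] <= N.[0] * (1 - x ^+ 2) ^+ n.+1.
Proof.
move=> /andP[x0 x1].
pose M := N.[0] *: (1 - 'X^2) ^+ n.+1 - N.
have ME y : M.[y] = N.[0] * (1 - y ^+ 2) ^+ n.+1 - N.[y].
  by rewrite hornerD hornerN hornerZ horner_exp !hornerE.
have dM y : M^`().[y] = (1 - y ^+ 2) ^+ n * (1 - 2 * n.+1%:R * N.[0] * y).
  rewrite derivB derivZ deriv_exp derivB derivC derivXn hornerD hornerN dNE.
  by rewrite hornerZ hornerMn !hornerE /=; ring.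
have n0 : 0 <= 2 * n.+1%:R * N.[0] by rewrite !mulr_ge0 // ltW // tail_gt0.
suff : 0 <= M.[x] by rewrite ME subr_ge0.
have [h|h] := leP (2 * n.+1%:R * N.[0] * x) 1.
- have <- : M.[0] = 0 by rewrite ME expr0n subr0 expr1n mulr1 subrr.
  apply: (@ler_hornerW _ 0 x) => //; rewrite ?in_itv /= ?lexx ?x0 // => y.
  rewrite in_itv /= dM => /andP[y0 yx].
  apply: mulr_ge0; first by apply: exprn_ge0; nra.
  by rewrite subr_ge0 (le_trans _ h) // ler_wpM2l // ltW.
- have M1 : M.[1] = 0 by rewrite ME N1 expr1n subrr expr0n mulr0 subr0.
  have -> : M.[x] = - (- M).[x] by rewrite hornerN opprK.
  rewrite oppr_ge0 -[leRHS]oppr0 -M1 -hornerN.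
  apply: (@ler_hornerW _ x 1) => //; rewrite ?in_itv /= ?lexx ?x1 // => y.
  rewrite in_itv /= derivN hornerN dM -mulrN => /andP[y0 y1].
  apply: mulr_ge0; first by apply: exprn_ge0; nra.
  by rewrite opprB subr_ge0 (le_trans (ltW h)) // ler_wpM2l // ltW.
Qed.

End DaubechiesPolynomial.

(** * The squared modulus of the mask as a polynomial in the cosine *)

Section MaskModulus.
Variable R : realType.
Implicit Types (t x y : R).

(** By the chain rule [N.[cos t]] has derivative [sin t * (1 - cos t ^+ 2) ^+ n], and [N.[1] = 0]
    makes it vanish at [t = 0]. *)
Lemma oriented_integral_sin (n : nat) (N : {poly R}) t :
  N^`() = - (1 - 'X^2) ^+ n -> N.[1] = 0 ->
  oriented_integral (fun w : R => sin w ^+ n.*2.+1) 0 t = N.[cos t].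
Proof.
move=> dN N1; pose F := horner N \o @cos R.
have dF x : is_derive x (1 : R) F (sin x ^+ n.*2.+1).
  have := @is_derive1_comp R (horner N) cos x _ _
            (is_derive_poly N (cos x)) (is_derive_cos x).
  congr is_derive.
  rewrite dN hornerN horner_exp !hornerE /= -sin2cos2 -exprM mul2n exprSr.
  by rewrite mulNr mulrN opprK.
have cF : continuous F by move=> x; apply/differentiable_continuous/derivable1_diffP; case: (dF x).
have I a b : a < b ->
    Rintegral (@lebesgue_measure R) `[a, b] (fun w => sin w ^+ n.*2.+1) = F b - F a.
  move=> ab; rewrite /Rintegral (@continuous_FTC2 _ _ F) //.
  - apply: continuous_subspaceT => x.
    apply: (@continuous_comp _ _ _ (@sin R) (fun y => y ^+ n.*2.+1)).
      exact: continuous_sin.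
    exact: exprn_continuous.
  - split; first by move=> x _; case: (dF x).
    + by apply: cvg_at_right_filter; exact: cF.
    + by apply: cvg_at_left_filter; exact: cF.
  - by move=> x _; rewrite derive1E; case: (dF x).
have F0 : F 0 = 0 by rewrite /F /= cos0.
rewrite /oriented_integral; have [t0|t0|<-] := ltgtP 0 t.
- by rewrite I // F0 subr0.
- by rewrite I // F0 sub0r opprK.
- by rewrite set_itv1 Rintegral_set1 cos0 N1.
Qed.

(** Later bounds on the mask use only these properties of [B]. The normalizing constant is the
    inverse of [N.[-1]], which reflection turns into [2 * N.[0]]. *)
Lemma daubechies_modulus (m : nat) : (0 < m)%N -> exists B : {poly R},
  [/\ forall t : R, 1 - daubechies_const R m *
        oriented_integral (fun w : R => sin w ^+ (2 * m - 1)%N) 0 t = B.[cos t],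
      forall x, -1 <= x <= 1 -> 0 <= B.[x] <= 1,
      forall x, 0 <= x <= 1 -> 1 - (1 - x ^+ 2) ^+ m <= B.[x]
    & forall x, -1 <= x <= 0 -> B.[x] <= (1 - x ^+ 2) ^+ m].
Proof.
case: m => // n _.
have [N [dN N1]] : exists N : {poly R}, N^`() = - (1 - 'X^2) ^+ n /\ N.[1] = 0.
  have [q dq] := poly_primitive (- (1 - 'X^2) ^+ n : {poly R}).
  exists (q - (q.[1])%:P).
  by rewrite derivB derivC subr0 hornerD hornerN hornerC subrr.
have N0 := tail_gt0 dN N1.
have NN x := tail_reflection dN x.
have e : (2 * n.+1 - 1 = n.*2.+1)%N by rewrite mul2n doubleS subn1.
rewrite e; exists (1 - (N.[-1])^-1 *: N).
have NN1 : N.[-1] = 2 * N.[0] by rewrite -(NN 1) N1 add0r.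
have BE x : (1 - (N.[-1])^-1 *: N).[x] = 1 - N.[x] / (2 * N.[0]).
  by rewrite hornerD hornerN hornerZ hornerC NN1 mulrC.
have N20 : 0 < 2 * N.[0] by rewrite mulr_gt0.
have ge0 x : -1 <= x <= 1 -> 0 <= N.[x].
  by move=> /andP[x0 x1]; rewrite -N1 (tail_antitone dN).
(* [tail_le] would even leave a factor 1/2 on the right, which is dropped. *)
have half x z : 0 <= x <= 1 -> z = N.[x] / (2 * N.[0]) ->
    z <= (1 - x ^+ 2) ^+ n.+1.
  move=> x01 ->; have := tail_le dN N1 x01.
  have : 0 <= (1 - x ^+ 2) ^+ n.+1 by apply: exprn_ge0; nra.
  by rewrite ler_pdivrMr //; nra.
split.
- move=> t; rewrite /daubechies_const e !(oriented_integral_sin _ dN N1) cospi.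
  by rewrite hornerD hornerN hornerZ hornerC.
- move=> x x1; rewrite BE; apply/andP; split.
    rewrite subr_ge0 ler_pdivrMr // mul1r -(NN x) lerDl ge0 //.
    by move: x1 => /andP[? ?]; apply/andP; split; lra.
  by rewrite gerBl divr_ge0 ?ge0 // ltW.
- by move=> x x1; rewrite BE lerD2l lerN2 (half x).
(* By reflection [B.[x]] is [N.[- x] / (2 * N.[0])], and [- x] lies in [0, 1]. *)
- move=> x x1; rewrite -sqrrN; apply: half.
    by move: x1 => /andP[? ?]; apply/andP; split; lra.
  have u : 2 * N.[0] != 0 by rewrite gt_eqF.
  by rewrite BE; apply: (mulIf u); rewrite mulrBl !divfK // mul1r -(NN x) addrAC subrr add0r.
Qed.

End MaskModulus.

(** * Products along orbits of the doubling map *)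

Section DoublingProducts.
Variables (R : realFieldType).
Implicit Types (y : nat -> R).

(* The orbit of the doubling map [t |-> 2 t] in the variable
   [y = sin (t / 2) ^+ 2].  A factor [4 y > 3] is followed by a factor small
   enough for their product to be at most [9]. *)
Lemma prod_doubling_le y n : (forall i, 0 <= y i <= 1) ->
  (forall i, y i.+1 = 4 * y i * (1 - y i)) ->
  \prod_(i < n) Num.max 2 (4 * y i) <= 4 / 3 * 3 ^+ n.
Proof.
have [k nk] := ubnP n.
elim: k n y nk => [//|k IH] n y nk y01 ys.
case: n nk => [|n] nk; first by rewrite big_ord0 expr0; lra.
have m0 j z : 0 <= \prod_(i < j) Num.max (2 : R) (z i).
  by apply: prodr_ge0 => i _; rewrite le_max ler0n.
have /andP[y0 y1] := y01 0%N.
have [le34|gt34] := leP (y 0%N) (3 / 4).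
  rewrite big_ord_recl /= exprS mulrCA.
  apply: ler_pM; [by rewrite le_max ler0n|exact: m0| |].
    by rewrite ge_max; apply/andP; split; lra.
  by apply: (IH n (y \o S)) => // i; [exact: y01|exact: ys].
(* A large factor in last position has no successor to compensate it; it is at most 4, whence the
   constant [4 / 3]. *)
case: n nk => [|n] nk.
  by rewrite big_ord_recl big_ord0 mulr1 expr1 ge_max /=; apply/andP; split; lra.
have := ys 0%N; move: (y01 1%N) => /andP[z0 z1] e.
rewrite 2!big_ord_recl mulrA (_ : _ * 3 ^+ _ = 3 * 3 * (4 / 3 * 3 ^+ n)) /=; last first.
  by rewrite !exprS; ring.
apply: ler_pM; [by rewrite mulr_ge0 // le_max ler0n|exact: m0| |]; last first.
  by apply: (IH n (fun i => y i.+2)) => //; exact: ltnW.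
rewrite (max_idPr _); last by lra.
rewrite /bump /= -[(1 + 0)%N]/1%N e; move: (y 0%N) y0 y1 gt34 => a a0 a1 a34.
rewrite maxr_pMr; last by lra.
rewrite ge_max; apply/andP; split; first lra.
(* This product is [9 - 64 * a ^+ 2 * (1 - a)], which vanishes at [a = 3 / 4]. *)
have : 0 <= (a - 3 / 4) * (64 * a ^+ 2 - 16 * a - 12) by apply: mulr_ge0; nra.
by nra.
Qed.

Lemma prod_doubling_decay y n : (forall i, 0 <= y i <= 1) ->
  (forall i, y i.+1 = 4 * y i * (1 - y i)) -> 2^-1 <= y 0%N ->
  \prod_(i < n) ((1 - y i) * Num.max 2 (4 * y i)) <= 8 / 3 * (3 / 4) ^+ n.
Proof.
move=> y01 ys y0; rewrite big_split /=.
(* The recurrence unrolled; [y n <= 1] and [y 0 >= 1/2] then bound the product of the [1 - y i] by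
   [2 / 4 ^+ n]. *)
have e : y 0%N * (4 ^+ n * \prod_(i < n) (1 - y i)) = y n.
  elim: n => [|n IH]; first by rewrite big_ord0 !mulr1.
  by rewrite big_ord_recr /= ys -IH exprS; ring.
have p0 : 0 <= \prod_(i < n) (1 - y i).
  by apply: prodr_ge0 => i _; case/andP: (y01 i) => _; rewrite subr_ge0.
have h := prod_doubling_le n y01 ys.
have c4 : 0 < (4 : R) ^+ n by rewrite exprn_gt0.
have : \prod_(i < n) (1 - y i) <= 2 / 4 ^+ n.
  rewrite ler_pdivlMr // mulrC.
  have := y01 n; rewrite -e => /andP[_ e1].
  have : 0 <= 4 ^+ n * \prod_(i < n) (1 - y i) by rewrite mulr_ge0 // ltW.
  by nra.
move=> /(ler_pM p0 _)/(_ h) => H.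
apply: (le_trans (H _)); first by apply: prodr_ge0 => i _; rewrite le_max ler0n.
by rewrite expr_div_n le_eqVlt; apply/orP; left; apply/eqP; field; rewrite gt_eqF.
Qed.

End DoublingProducts.

(** * Convergence of infinite products of complex numbers *)

Section ComplexLimits.
Variable R : realType.
Implicit Types (z : R[i]) (u : nat -> R[i]).
Local Open Scope complex_scope.

Lemma normc_ge0 z : 0 <= Normc.normc z.
Proof. by case: z => a b; exact: sqrtr_ge0. Qed.

Lemma complex_normrE z : `|z| = (Normc.normc z)%:C.
Proof. by []. Qed.

Lemma normc_le_ReIm z : Normc.normc z <= `|complex.Re z| + `|complex.Im z|.
Proof.
case: z => a b /=; rewrite -[leRHS]ger0_norm ?addr_ge0 // -sqrtr_sqr ler_wsqrtr //.
rewrite -(real_normK (num_real a)) -(real_normK (num_real b)).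
by have := normr_ge0 a; have := normr_ge0 b; nra.
Qed.

Lemma Re_le_normc z : `|complex.Re z| <= Normc.normc z.
Proof. by case: z => a b /=; rewrite -sqrtr_sqr ler_wsqrtr // lerDl sqr_ge0. Qed.

Lemma Im_le_normc z : `|complex.Im z| <= Normc.normc z.
Proof. by case: z => a b /=; rewrite -sqrtr_sqr ler_wsqrtr // lerDr sqr_ge0. Qed.

Lemma cvg_complex u (a b : R) :
  (fun n => complex.Re (u n)) @ \oo --> a ->
  (fun n => complex.Im (u n)) @ \oo --> b ->
  (u : nat -> R[i]^o) @ \oo --> (a +i* b : R[i]^o).
Proof.
move=> ua ub; apply/cvgrPdist_lt => -[e e'].
rewrite ltcE /= => /andP[/eqP -> e0].
have e20 : 0 < e / 2 by rewrite divr_gt0.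
move/cvgrPdist_lt : ua => /(_ _ e20) ua; move/cvgrPdist_lt : ub => /(_ _ e20) ub.
near=> n.
rewrite complex_normrE ltcR (le_lt_trans (normc_le_ReIm _)) //.
have -> : complex.Re (a +i* b - u n) = a - complex.Re (u n) by case: (u n).
have -> : complex.Im (a +i* b - u n) = b - complex.Im (u n) by case: (u n).
by rewrite [ltRHS]splitr; apply: ltrD; near: n.
Unshelve. all: by end_near. Qed.

Lemma geometric_steps_cvg (v : nat -> R) (C : R) :
  (forall n, `|v n.+1 - v n| <= C * 2^-1 ^+ n) -> cvgn v.
Proof.
move=> vC.
have e : v = (fun n => v 0%N + series (fun k => v k.+1 - v k) n).
  by apply/funext => n; rewrite /series /= telescope_sumr // addrCA subrr addr0.
rewrite e; apply: is_cvgD; first exact: is_cvg_cst.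
apply: normed_cvg; apply: (@series_le_cvg _ _ (geometric C 2^-1)) => //=.
- by move=> n; exact: le_trans (vC n).
- apply: is_cvg_geometric_series.
  by rewrite ger0_norm // invf_lt1 // ltr1n.
Qed.

(** [infinite_product] is a [limn], so a limit must first be shown to exist. Partial products stay
    in the unit disc, hence consecutive ones differ by at most the distance from the new factor to
    1, which is geometrically small. *)
Lemma infinite_product_cvg u (C : R) :
  (forall l, Normc.normc (u l) <= 1) ->
  (forall l, Normc.normc (u l - 1) <= C * 2^-1 ^+ l) ->
  (fun n => Normc.normc (\prod_(1 <= l < n.+1) u l)) @ \oo -->
    Normc.normc (infinite_product u).
Proof.
move=> u1 uC; pose P n := \prod_(1 <= l < n.+1) u l.
have P1 n : Normc.normc (P n) <= 1.
  rewrite /P; elim: n => [|n IH]; first by rewrite big_geq // Normc.normc1.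
  by rewrite big_nat_recr //= Normc.normcM mulr_ile1 // normc_ge0.
have C0 : 0 <= C by have := le_trans (normc_ge0 _) (uC 0%N); rewrite expr0 mulr1.
have dP n : Normc.normc (P n.+1 - P n) <= C * 2^-1 ^+ n.
  rewrite {1}/P big_nat_recr //= -/(P n) -[X in _ - X]mulr1 -mulrBr Normc.normcM.
  apply: (@le_trans _ _ (1 * (C * 2^-1 ^+ n.+1))).
    by rewrite ler_pM // normc_ge0.
  by rewrite mul1r ler_wpM2l // exprS ger_pMl ?exprn_gt0 ?invr_gt0 // invf_le1 // ler1n.
have cR : cvgn (fun n => complex.Re (P n)).
  apply: (@geometric_steps_cvg _ C) => n; apply: le_trans (dP n).
  by rewrite (le_trans _ (Re_le_normc _)) //; case: (P n.+1); case: (P n).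
have cI : cvgn (fun n => complex.Im (P n)).
  apply: (@geometric_steps_cvg _ C) => n; apply: le_trans (dP n).
  by rewrite (le_trans _ (Im_le_normc _)) //; case: (P n.+1); case: (P n).
have := cvg_complex cR cI => cP.
rewrite /infinite_product (cvg_lim _ cP); last exact: norm_hausdorff.
move/cvg_norm : cP => /cvgrPdist_lt cP; apply/cvgrPdist_lt => e e0.
(* [cvg_norm] yields norms valued in [R[i]]; this identity carries their convergence back to [R]. *)
have distE z1 z2 : `| `|z1| - `|z2| | = `|Normc.normc z1 - Normc.normc z2|%:C.
  by rewrite !complex_normrE /= subr0 expr0n addr0 sqrtr_sqr.
have e0' : 0 < e%:C :> R[i] by rewrite ltcR.
have := cP _ e0'; apply: filterS => n h.
by rewrite -ltcR -distE; exact: h.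
Qed.

Lemma lipschitz1_is_derive (f df : R -> R) : (forall x : R, is_derive x (1 : R) f (df x)) ->
  (forall x, `|df x| <= 1) -> forall x y, `|f x - f y| <= `|x - y|.
Proof.
move=> fdf df1 x y; wlog yx : x y / y < x => [wl|].
  by have [/wl|/wl|->] := ltgtP x y; rewrite ?subrr // distrC [leRHS]distrC.
have [c _ ->] : exists2 c, c \in `]y, x[%R & f x - f y = df c * (x - y).
  apply: MVT => //; apply: continuous_subspaceT => z.
  by apply/differentiable_continuous/derivable1_diffP; case: (fdf z).
by rewrite normrM ler_piMl.
Qed.

(** With [H 0 = 1] this makes [H (2 ^- l * w)] geometrically close to 1. Each term is estimated by
    [dc_le] at [s = - (nu * t)]. *)
Lemma normc_trig_poly_sub (H : R -> R[i]) : trig_poly H ->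
  exists C : R, forall t, Normc.normc (H t - H 0) <= C * `|t|.
Proof.
have sinle (s : R) : `|sin s| <= `|s|.
  have := @lipschitz1_is_derive _ _ (is_derive_sin (R := R)) (fun x => cos_max x) s 0.
  by rewrite sin0 !subr0.
have cosle (s : R) : `|cos s - 1| <= `|s|.
  have := @lipschitz1_is_derive _ _ (is_derive_cos (R := R)) _ s 0.
  by rewrite cos0 !subr0; apply => x; rewrite normrN sin_max.
have dc_le (s : R) : Normc.normc (expi s - 1) <= 2 * `|s|.
  rewrite (le_trans (normc_le_ReIm _)) // mulrDl mul1r; apply: lerD => //=.
  by rewrite subr0.
case=> L [h hE].
exists (\sum_(0 <= nu < L.+1) Normc.normc (h nu) * (2 * nu%:R)) => t.
rewrite !hE -sumrB mulr_suml.
elim/big_rec2 : _ => [|nu x y _ xy]; first by rewrite Normc.normc0.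
rewrite (le_trans (le_normcD _ _)) // lerD //.
rewrite mulr0 oppr0 {2}/expi cos0 sin0.
rewrite -mulrBr Normc.normcM -mulrA ler_wpM2l ?normc_ge0 //.
by rewrite (le_trans (dc_le _)) // normrN normrM normr_nat mulrA.
Qed.

End ComplexLimits.

(** Weierstrass's product inequality, by induction; the [c i] may exceed 1. *)
Lemma prod_ge_1_sub_sum (R : realDomainType) (b c : nat -> R) n :
  (forall i, 0 <= b i <= 1) -> (forall i, 1 - c i <= b i) -> (forall i, 0 <= c i) ->
  1 - \sum_(0 <= i < n) c i <= \prod_(0 <= i < n) b i.
Proof.
move=> b01 cb c0; elim: n => [|n IH]; first by rewrite !big_geq // subr0.
rewrite !big_nat_recr //=.
have p0 : 0 <= \prod_(0 <= i < n) b i.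
  by apply: prodr_ge0 => i _; case/andP: (b01 i).
have p1 : \prod_(0 <= i < n) b i <= 1 by apply: prodr_ile1 => i _.
by move: (b01 n) (cb n) (c0 n) => /andP[b0 b1]; nra.
Qed.

(** * Bounds on the modulus of the infinite product for a fixed order *)

Section ScalingModulus.
Variable R : realType.
Implicit Types (t w x : R).

Lemma pi_lt4 : pi < 4 :> R.
Proof. by have := @pihalf_lt2 R; lra. Qed.

Lemma cos_lt0_pihalf t : pi / 2 < t <= pi -> cos t < 0.
Proof.
move=> /andP[t0 t1]; rewrite -cos_pihalf ltr_cos // in_itv /=.
- by have := @pi_gt0 R; move=> ?; apply/andP; split; lra.
- by have := @pi_gt0 R; move=> ?; apply/andP; split; lra.
Qed.

(** [J] is the least exponent that brings [|w|] down to at most [pi]; by minimality one halving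
    fewer leaves more than [pi]. *)
Lemma dyadic_scale w : pi < `|w| -> exists J : nat, pi / 2 < 2 ^- J * `|w| <= pi.
Proof.
move=> wpi.
have exP : exists n : nat, 2 ^- n * `|w| <= pi.
  exists (Num.truncn `|w|).+1.
  rewrite mulrC ler_pdivrMr ?exprn_gt0 // (@le_trans _ _ (1 * 2 ^+ (Num.truncn `|w|).+1)) //.
    rewrite mul1r (le_trans (ltW (truncnS_gt _))) // -natrX ler_nat.
    exact: ltnW (ltn_expl _ _).
  by rewrite ler_wpM2r ?exprn_ge0 //; have := @pi_ge2 R; lra.
case: (ex_minnP exP) => -[|J] hJ minJ.
  by move: hJ; rewrite expr0 invr1 mul1r leNgt wpi.
exists J.+1; rewrite hJ andbT ltNge; apply/negP => h.
have : 2 ^- J * `|w| <= pi.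
  have -> : 2 ^- J = 2 * 2 ^- J.+1 :> R by rewrite exprS invfM mulVKf.
  by rewrite -mulrA; lra.
by move/minJ; rewrite ltnn.
Qed.

Variables (m : nat) (H : R -> R[i]).
Hypotheses (m0 : (0 < m)%N) (mH : daubechies_mask m H).

(** Up to the factor [(Num.sqrt (2 * pi))^-1], the modulus of the Fourier transform of the scaling
    function. *)
Local Notation Psi w := (Normc.normc (infinite_product (fun l => H (2 ^- l * w)))).

Lemma mask_normc_le1 t : Normc.normc (H t) <= 1.
Proof.
have [B [BE B01 _ _]] := daubechies_modulus R m0; case: mH => _ mod _.
rewrite -(@ler_pXn2r _ 2) ?nnegrE ?normc_ge0 // expr1n mod BE.
by have /andP[] : 0 <= B.[cos t] <= 1 by rewrite B01 // cos_geN1 cos_le1.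
Qed.

Lemma partial_product_cvg w :
  (fun n => \prod_(1 <= l < n.+1) Normc.normc (H (2 ^- l * w))) @ \oo --> Psi w.
Proof.
case: mH => tH mod H0; have [C HC] := normc_trig_poly_sub tH.
rewrite (_ : (fun n => _) = fun n =>
    Normc.normc (\prod_(1 <= l < n.+1) H (2 ^- l * w))); last first.
  apply/funext => n; apply/esym.
  by apply: (big_morph _ (@Normc.normcM R)); exact: Normc.normc1.
apply: (@infinite_product_cvg _ _ (C * `|w|)) => l; first exact: mask_normc_le1.
rewrite -H0 (le_trans (HC _)) // normrM mulrA mulrAC exprVn.
by rewrite [`|2 ^- l|]ger0_norm // invr_ge0 exprn_ge0.
Qed.

Lemma scaling_modulus_le w n :
  Psi w <= \prod_(1 <= l < n.+1) Normc.normc (H (2 ^- l * w)).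
Proof.
rewrite -(cvg_lim _ (@partial_product_cvg w)); last exact: norm_hausdorff.
apply: nonincreasing_cvgn_ge; last by apply/cvg_ex; eexists; exact: partial_product_cvg.
apply/nonincreasing_seqP => k; rewrite [leLHS]big_nat_recr //= ler_piMr ?mask_normc_le1 //.
by apply: prodr_ge0 => i _; exact: normc_ge0.
Qed.

Lemma scaling_modulus_le1 w : Psi w <= 1.
Proof. by have := scaling_modulus_le w 0; rewrite big_geq. Qed.

(** For [|w| < pi] every angle [2 ^- l * w] has nonnegative cosine, so each squared factor is at
    least 1 minus a power of a sine. These deficits are summed by Weierstrass's inequality. *)
Lemma scaling_modulus_ge w : `|w| < pi -> 1 - 2 * (sin (w / 2) ^+ 2) ^+ m <= Psi w ^+ 2.
Proof.
move=> wpi; have [B [BE B01 Bge _]] := daubechies_modulus R m0; case: mH => _ mod _.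
set s := sin (w / 2) ^+ 2.
have cvgP2 : (fun n => (\prod_(1 <= l < n.+1) Normc.normc (H (2 ^- l * w))) ^+ 2) @ \oo -->
    Psi w ^+ 2.
  rewrite expr2; under eq_fun do rewrite expr2.
  by apply: cvgM; exact: partial_product_cvg.
rewrite -(cvg_lim _ cvgP2); last exact: norm_hausdorff.
apply: limr_ge; first by apply/cvg_ex; eexists; exact: cvgP2.
near=> n.
rewrite -prodrXl big_add1 /=.
have half (l : nat) : 2 ^- l.+1 * w = (2 ^- l.+2 * w) *+ 2.
  by rewrite -[RHS]mulr_natl mulrA [in RHS]exprS invfM mulVKf.
have cos0 (l : nat) : 0 <= cos (2 ^- l.+1 * w).
  apply: cos_ge0_pihalf; rewrite -ler_norml normrM ger0_norm ?invr_ge0 ?exprn_ge0 //.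
  rewrite mulrC; apply: ler_pM => //; first exact: ltW.
  by rewrite lef_pV2 ?posrE ?exprn_gt0 // exprS ler_peMr // exprn_ege1 // ler1n.
(* If [cos (2 v) >= 0] then [cos v ^+ 2 >= 1/2], so the double-angle formula for the sine gives
   [sin v ^+ 2 <= sin (2 v) ^+ 2 / 2]. *)
have sinle (l : nat) : sin (2 ^- l.+1 * w) ^+ 2 <= 2 ^- l * s.
  elim: l => [|l IH]; first by rewrite expr0 invr1 mul1r expr1 [_ * w]mulrC.
  have := cos2Dsin2 (2 ^- l.+2 * w).
  move: IH (cos0 l); rewrite half cos_mulr2n sin_mulr2n.
  move: (2 ^- l.+2 * w) => v; rewrite [2 ^+ l.+1]exprS invfM -mulrA.
  move: (2 ^- l * s) (cos v) (sin v) => r c d; nra.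
have c01 t : -1 <= cos t <= 1 by rewrite cos_geN1 cos_le1.
have s0 : 0 <= s by rewrite sqr_ge0.
apply: le_trans (@prod_ge_1_sub_sum _ _ (fun l => 2 ^- l * s ^+ m) n _ _ _); last 3 first.
- by move=> l; rewrite mod BE B01.
- move=> l; rewrite mod BE.
  apply: le_trans (Bge _ _); last by rewrite cos0 cos_le1.
  rewrite lerD2l lerN2 -sin2cos2.
  rewrite (@le_trans _ _ ((2 ^- l * s) ^+ m)) //.
    by rewrite lerXn2r ?nnegrE ?sqr_ge0 // mulr_ge0 // invr_ge0 exprn_ge0.
  (* As [m] is positive, [(2 ^- l) ^+ m <= 2 ^- l], which leaves a geometric series of sum at most
     2. *)
  rewrite exprMn ler_wpM2r ?(exprn_ge0 _ s0) //.
  rewrite ler_iXnr ?invr_ge0 ?exprn_ge0 //.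
  by rewrite invf_le1 ?exprn_gt0 // exprn_ege1 // ler1n.
- by move=> l; rewrite mulr_ge0 ?(exprn_ge0 _ s0) ?invr_ge0 ?exprn_ge0.
rewrite lerD2l lerN2 -mulr_suml ler_wpM2r ?(exprn_ge0 _ s0) //.
have -> : \sum_(0 <= i < n) 2 ^- i = 2 - 2 * 2 ^- n :> R.
  elim: (n) => [|k IH]; first by rewrite big_geq // expr0 invr1 mulr1 subrr.
  by rewrite big_nat_recr //= IH exprS invfM; field; rewrite expf_neq0.
by rewrite gerBl mulr_ge0 // invr_ge0 exprn_ge0.
Unshelve. all: by end_near. Qed.

Lemma scaling_modulus_le_factor w l : (0 < l)%N -> cos (2 ^- l * w) <= 0 ->
  Psi w ^+ 2 <= (1 - cos (2 ^- l * w) ^+ 2) ^+ m.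
Proof.
move=> l0 cl; have [B [BE B01 _ Ble]] := daubechies_modulus R m0; case: mH => _ mod _.
apply: le_trans (Ble _ _); last by rewrite cos_geN1 cl.
rewrite -BE -mod lerXn2r ?nnegrE ?normc_ge0 //.
rewrite (le_trans (scaling_modulus_le w l)) // big_nat_recr //=.
rewrite ler_piMl ?normc_ge0 //.
rewrite big_seq prodr_ile1 // => i _; rewrite normc_ge0 mask_normc_le1 //.
Qed.

Lemma mask_normc_doubling t :
  Normc.normc (H t) ^+ 2 <=
    ((1 - (1 - cos t) / 2) * Num.max 2 (4 * ((1 - cos t) / 2))) ^+ m.
Proof.
have [B [BE B01 _ Ble]] := daubechies_modulus R m0; case: mH => _ mod _.
rewrite mod BE; have [c0 c1] := (cos_geN1 t, cos_le1 t).
(* For [c >= 0] the base is [1 + c], so [B <= 1] suffices; for [c < 0] it is [1 - c ^+ 2]. *)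
move: (cos t) c0 c1 => c c0 c1; have [cpos|cneg] := leP 0 c.
  apply: (@le_trans _ _ 1); first by have /andP[] : 0 <= B.[c] <= 1 by rewrite B01 // c0.
  by rewrite (max_idPl _) ?exprn_ege1 //; lra.
rewrite (max_idPr _); last by lra.
apply: le_trans (Ble _ _) _; first by rewrite c0 ltW.
by rewrite le_eqVlt; apply/orP; left; apply/eqP; congr (_ ^+ _); field.
Qed.

Lemma scaling_modulus_decay w (J : nat) : cos (2 ^- J * w) <= 0 ->
  Psi w ^+ 2 <= (8 / 3 * (3 / 4) ^+ J) ^+ m.
Proof.
move=> cJ; pose y i := (1 - cos (2 ^+ i * (2 ^- J * w))) / 2.
have y01 i : 0 <= y i <= 1.
  rewrite /y; have := cos_geN1 (2 ^+ i * (2 ^- J * w)).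
  have := cos_le1 (2 ^+ i * (2 ^- J * w)).
  by move=> ? ?; apply/andP; split; lra.
have ys i : y i.+1 = 4 * y i * (1 - y i).
  by rewrite /y exprS -mulrA mulr_natl cos_mulr2n; field.
have y0 : 2^-1 <= y 0%N by rewrite /y expr0 mul1r; lra.
have := prod_doubling_decay J y01 ys y0.
have p0 : 0 <= \prod_(i < J) ((1 - y i) * Num.max 2 (4 * y i)).
  apply: prodr_ge0 => i _; rewrite mulr_ge0 ?le_max ?ler0n //.
  by case/andP: (y01 i); rewrite subr_ge0.
move=> h.
apply: le_trans (_ : _ <= (\prod_(i < J) ((1 - y i) * Num.max 2 (4 * y i))) ^+ m) _;
  last first.
  by rewrite lerXn2r ?nnegrE ?mulr_ge0 ?exprn_ge0 ?divr_ge0.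
rewrite -prodrXl.
apply: (@le_trans _ _ ((\prod_(1 <= l < J.+1) Normc.normc (H (2 ^- l * w))) ^+ 2)).
  rewrite lerXn2r ?nnegrE ?normc_ge0 ?scaling_modulus_le //.
  by apply: prodr_ge0 => i _; exact: normc_ge0.
(* The orbit starts at the angle [2 ^- J * w] and doubles up to [w / 2], opposite to the order of
   the product: index [i] matches [l = J - i]. *)
rewrite -prodrXl big_add1 big_nat_rev add0n big_mkord.
apply: ler_prod => i _; rewrite exprn_ge0 ?normc_ge0 //=.
have e (a : nat) : (a <= J)%N -> 2 ^- (J - a) * w = 2 ^+ a * (2 ^- J * w).
  by move=> aJ; rewrite -{2}(subnKC aJ) exprD invfM -mulrA mulVKf // expf_neq0.
by rewrite subnSK // e ?mask_normc_doubling // ltnW.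
Qed.

(** Three powers of [3 / 4] gain a factor 1/2, and the bound is on the square of the modulus: hence
    6 orders per power of [|w|]. *)
Lemma scaling_modulus_poly_decay w K : (6 * K <= m)%N -> Psi w * `|w| ^+ K <= 76 ^+ K.
Proof.
move=> Km; have [wpi|wpi] := leP `|w| pi.
  rewrite -[leRHS]mul1r ler_pM ?normc_ge0 ?scaling_modulus_le1 //.
  by rewrite lerXn2r ?nnegrE // (le_trans wpi) //; have := pi_lt4; lra.
have [J /andP[J1 J2]] := dyadic_scale wpi.
have w0 : 0 < `|w| by rewrite (lt_trans _ wpi) // pi_gt0.
have cJ : cos (2 ^- J * w) <= 0.
  rewrite -cos_norm normrM ger0_norm ?invr_ge0 ?exprn_ge0 //.
  by rewrite ltW // cos_lt0_pihalf // J1.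
set a : R := 8 / 3 * (3 / 4) ^+ J.
have a0 : 0 <= a by rewrite mulr_ge0 ?exprn_ge0 ?divr_ge0.
have a6 : Psi w ^+ 2 <= a ^+ (6 * K).
  have [a1|a1] := leP a 1.
    apply: (le_trans (scaling_modulus_decay cJ)).
    by rewrite ler_wiXn2l.
  rewrite (@le_trans _ _ 1) ?exprn_ile1 ?normc_ge0 ?scaling_modulus_le1 //.
  by rewrite exprn_ege1 // ltW.
(* (8/3)^3 < 19, (3/4)^3 < 1/2 and 19 pi < 76. *)
have a3 : a ^+ 3 <= 19 * 2 ^- J.
  rewrite exprMn exprAC -exprVn; apply: ler_pM; rewrite ?exprn_ge0 ?divr_ge0 //.
    by rewrite !exprS expr0; lra.
  by apply: lerXn2r; rewrite ?nnegrE ?exprn_ge0 ?divr_ge0 ?invr_ge0 // !exprS expr0; lra.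
have PsiK : Psi w <= (19 * 2 ^- J) ^+ K.
  rewrite -(@ler_pXn2r _ 2) ?nnegrE ?normc_ge0 ?exprn_ge0 ?mulr_ge0 ?invr_ge0 ?exprn_ge0 //.
  rewrite (le_trans a6) // -exprM (_ : (6 * K = 3 * (K * 2))%N) ?exprM; last first.
    by rewrite [(K * 2)%N]mulnC mulnA.
  by rewrite -[leRHS]exprM -[leLHS]exprM lerXn2r ?nnegrE ?exprn_ge0 ?mulr_ge0 ?invr_ge0 ?exprn_ge0.
apply: (le_trans (ler_wpM2r _ PsiK)); first by rewrite exprn_ge0.
rewrite -exprMn lerXn2r ?nnegrE ?mulr_ge0 ?invr_ge0 ?exprn_ge0 //.
by have := pi_lt4; rewrite -mulrA; lra.
Qed.

(** The decay bounds for [k] and [k.+2] add up to one for [|w| ^+ k * (1 + w ^+ 2)]. The majorant is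
    integrable and independent of [m]. *)
Lemma scaling_modulus_dominated w k : (6 * k.+2 <= m)%N ->
  `|w| ^+ k * Psi w <= (76 ^+ k + 76 ^+ k.+2) * (oneDsqr w)^-1.
Proof.
move=> km; rewrite ler_pdivlMr // /oneDsqr -(real_normK (num_real w)).
have h1 : Psi w * `|w| ^+ k <= 76 ^+ k.
  apply: scaling_modulus_poly_decay; apply: leq_trans km.
  by rewrite leq_mul2l ltnW // ltnW.
have h2 := scaling_modulus_poly_decay w km.
rewrite mulrDr mulr1 mulrC; apply: lerD => //.
by rewrite -mulrA -exprD addn2.
Qed.

End ScalingModulus.

(** * Limits and integrals of real powers *)

Section PowerIntegrals.
Variable R : realType.
Local Notation mu := (@lebesgue_measure R).
Implicit Types (x a b c p : R).

Lemma cvg_powR (T : Type) (F : set_system T) (FF : Filter F) (u : T -> R) (l p : R) :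
  0 < p -> 0 <= l -> (forall t, 0 <= u t) -> u t @[t --> F] --> l ->
  u t `^ p @[t --> F] --> l `^ p.
Proof.
move=> p0; rewrite le_eqVlt => /orP[/eqP <-|l0] u0 ul; last first.
  have cl : {for l, continuous (fun x => x `^ p)}.
    apply/differentiable_continuous/derivable1_diffP.
    by case: (is_derive1_powR p l0).
  exact: (cvg_comp _ _ ul cl).
rewrite powR0 ?gt_eqF //; apply/cvgr0Pnorm_lt => e e0.
move/cvgr0Pnorm_lt : ul => /(_ (e `^ p^-1)); rewrite powR_gt0 // => /(_ isT).
apply: filterS => t; rewrite !ger0_norm ?powR_ge0 // => ut.
rewrite (_ : e = (e `^ p^-1) `^ p); last by rewrite -powRrM mulVf ?gt_eqF // powRr1 // ltW.
by apply: gt0_ltr_powR; rewrite ?nnegrE ?powR_ge0.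
Qed.

Lemma continuous_norm_powR a : 0 <= a -> continuous (fun x => `|x| `^ a).
Proof.
rewrite le_eqVlt => /orP[/eqP <-|a0] x.
  by under eq_fun do rewrite powRr0; exact: cst_continuous.
by apply: cvg_powR => //; exact: norm_continuous.
Qed.

Lemma integral_norm_powR a c : 0 <= a -> 0 < c ->
  (\int[mu]_(x in `[(- c)%R, c]) (`|x| `^ a)%:E = (2 * (c `^ (a + 1) / (a + 1)))%:E)%E.
Proof.
move=> a0 c0; have a1 : 0 < a + 1 by rewrite ltr_wpDl.
have cf := continuous_norm_powR a0.
have half : (\int[mu]_(x in `[0%R, c]) (`|x| `^ a)%:E = (c `^ (a + 1) / (a + 1))%:E)%E.
  pose F x := x `^ (a + 1) / (a + 1).
  have dF x : 0 < x -> is_derive x (1 : R) F (x `^ a).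
    move=> x0; have := is_derive1_powR (a + 1) x0; rewrite addrK => h.
    rewrite /F; under eq_fun do rewrite mulrC.
    have -> : x `^ a = (a + 1)^-1 *: ((a + 1) * x `^ a) by rewrite /GRing.scale /= mulKf ?gt_eqF.
    exact: is_deriveZ.
  rewrite (@continuous_FTC2 _ (fun x => `|x| `^ a) F) //.
  - by rewrite {2}/F powR0 ?gt_eqF // mul0r sube0.
  - exact: continuous_subspaceT.
  - split.
    + by move=> x; rewrite in_itv /= => /andP[x0 _]; case: (dF x x0).
    + rewrite /F powR0 ?gt_eqF // mul0r -[X in _ --> X](mul0r (a + 1)^-1).
      by apply: cvgM; [exact: powR_cvg0|exact: cvg_cst].
    + apply: cvg_at_left_filter; apply/differentiable_continuous/derivable1_diffP.
      by case: (dF c c0).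
  - move=> x; rewrite in_itv /= => /andP[x0 _].
    by rewrite derive1E; case: (dF x x0) => _ ->; rewrite gtr0_norm.
have -> : `[(- c)%R, c]%classic = `[- c, 0[%classic `|` `[0, c]%classic.
  apply/seteqP; split => x /=; rewrite !in_itv /=.
    by move=> /andP[-> ->]; case: ltP; [left|right].
  by move=> [|] /andP[h1 h2]; apply/andP; split; lra.
have mf (D : set R) : measurable_fun D (fun x => `|x| `^ a).
  by apply: measurable_funTS; exact: continuous_measurable_fun.
rewrite ge0_integral_setU //=; last 2 first.
- by apply/measurable_EFinP; exact: mf.
- apply/disj_setPS => x /=; rewrite !in_itv /= => -[/andP[_ h1] /andP[h2 _]].
  by move: h2; rewrite leNgt h1.
rewrite integral_itv_bndo_bndc; last by apply/measurable_EFinP; exact: mf.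
rewrite half.
have := @integration_by_substitution_oppr _ (fun x => `|x| `^ a) 0 c (ltW c0) _.
rewrite oppr0 => -> //; last exact: continuous_subspaceT.
under eq_integral do rewrite /= normrN.
by rewrite half -EFinD -mulr2n mulr_natl.
Qed.

Lemma integrable_oneDsqrV : mu.-integrable setT (EFin \o (fun x => (oneDsqr x)^-1)).
Proof.
have ge0 x : 0 <= (oneDsqr x)^-1 by rewrite invr_ge0 ltW.
have cf : continuous (fun x : R => (oneDsqr x)^-1) by exact: continuous_oneDsqrV.
apply/integrableP; split.
  by apply/measurable_EFinP; exact: continuous_measurable_fun.
under eq_integral do rewrite /= ger0_norm ?ge0 //.
rewrite ge0_symfun_integralT //; last by move=> x; rewrite /oneDsqr /= sqrrN.
rewrite (_ : [set x | _] = `[0, +oo[%classic); last first.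
  by apply/seteqP; split => x /=; rewrite in_itv /= andbT.
by rewrite integral0y_oneDsqr -EFinM ltry.
Qed.

End PowerIntegrals.

(** * Passage to the limit in the order [m] *)

Section Limit.
Variables (R : realType) (H : nat -> R -> R[i]).
Hypothesis mH : forall m, (0 < m)%N -> daubechies_mask m (H m).
Local Notation mu := (@lebesgue_measure R).

Local Notation Psi m w :=
  (Normc.normc (infinite_product (fun l => H m (2 ^- l * w)))).

(** A pointwise limit of finite products of continuous functions: the modulus of the mask is the
    square root of [B] at a cosine. *)
Lemma measurable_scaling_modulus m : (0 < m)%N ->
  measurable_fun setT (fun w : R => Psi m w).
Proof.
move=> m0; have [B [BE _ _ _]] := daubechies_modulus R m0.
have [_ mod _] := mH m0.
pose h n (w : R) := \prod_(1 <= l < n.+1) Normc.normc (H m (2 ^- l * w)).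
apply: (@measurable_fun_cvg _ _ R setT h) => [n|w _]; last exact: (partial_product_cvg m0 (mH m0)).
apply: measurable_prod => l _.
apply: continuous_measurable_fun.
rewrite (_ : (fun w => _) = @Num.sqrt R \o (horner B \o (@cos R \o *%R (2 ^- l)))); last first.
  by apply/funext => w /=; rewrite -BE -mod sqrtr_sqr ger0_norm // normc_ge0.
move=> w; apply: continuous_comp; last exact: sqrt_continuous.
apply: continuous_comp; last exact: continuous_horner.
by apply: continuous_comp; [exact: mulrl_continuous|exact: continuous_cos].
Qed.

Lemma scaling_modulus_cvg1 (w : R) : `|w| < pi -> (fun m => Psi m w) @ \oo --> (1 : R).
Proof.
move=> wpi; have [c0 c1] : -1 <= cos (w / 2) <= 1 /\ 0 < cos (w / 2).
  rewrite cos_geN1 cos_le1; split => //; apply: cos_gt0_pihalf.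
  by rewrite -ltr_norml normrM [`|2^-1|]ger0_norm // ltr_pM2r.
have s1 : `|sin (w / 2) ^+ 2| < 1.
  by rewrite ger0_norm ?sqr_ge0 // sin2cos2; nra.
apply: (@squeeze_cvgr _ _ _ _ (fun m => 1 - 2 * (sin (w / 2) ^+ 2) ^+ m) (fun=> 1)).
- near=> m; have m0 : (0 < m)%N by near: m; exact: nbhs_infty_gt.
  rewrite (scaling_modulus_le1 m0 (mH m0)) andbT.
  apply: le_trans (scaling_modulus_ge m0 (mH m0) wpi) _.
  by rewrite expr2 ler_piMl ?normc_ge0 // (scaling_modulus_le1 m0 (mH m0)).
- rewrite -[X in _ --> X]subr0 -[X in _ - X](mulr0 2).
  by apply: cvgB; [|apply: cvgM; [|exact: cvg_expr]]; exact: cvg_cst.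
- exact: cvg_cst.
Unshelve. all: by end_near. Qed.

Lemma scaling_modulus_cvg0 (w : R) : pi < `|w| -> (fun m => Psi m w) @ \oo --> (0 : R).
Proof.
move=> wpi; have [J J12] := dyadic_scale wpi.
have cJ : cos (2 ^- J * w) < 0.
  rewrite -cos_norm normrM [`|2 ^- J|]ger0_norm ?invr_ge0 ?exprn_ge0 //.
  exact: cos_lt0_pihalf.
(* The product starts at [l = 1], so the scale [J] must be one of its indices. *)
have J0 : (0 < J)%N.
  by case: (J) J12 => //; rewrite expr0 invr1 mul1r leNgt wpi andbF.
set b := 1 - cos (2 ^- J * w) ^+ 2.
have b1 : `|b| < 1.
  rewrite /b -sin2cos2 ger0_norm ?sqr_ge0 // sin2cos2.
  by have := cos_geN1 (2 ^- J * w); nra.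
have Psi2 : (fun m => Psi m w ^+ 2) @ \oo --> (0 : R).
  apply: (@squeeze_cvgr _ _ _ _ (fun=> 0) (fun m => b ^+ m)).
  - near=> m; have m0 : (0 < m)%N by near: m; exact: nbhs_infty_gt.
    by rewrite sqr_ge0 (scaling_modulus_le_factor m0 (mH m0)) // ltW.
  - exact: cvg_cst.
  - exact: cvg_expr.
rewrite (_ : (fun m => _) = (fun m => Num.sqrt (Psi m w ^+ 2))); last first.
  by apply/funext => m; rewrite sqrtr_sqr ger0_norm // normc_ge0.
rewrite -(sqrtr0 R).
exact: (cvg_comp _ _ Psi2 (@sqrt_continuous R 0)).
Unshelve. all: by end_near. Qed.

(** Dominated convergence. Finiteness is recorded because the p-th root is later taken of [fine]
    values. *)
Lemma integral_scaling_modulus_cvg (p c : R) (k : nat) : 1 < p -> 0 <= c ->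
  (\forall m \near \oo,
    (\int[mu]_w ((`|w| ^+ k * (c * Psi m w)) `^ p)%:E)%E \is a fin_num) /\
  (fun m => \int[mu]_w ((`|w| ^+ k * (c * Psi m w)) `^ p)%:E)%E @ \oo -->
    (c `^ p * (2 * (pi `^ (k%:R * p + 1) / (k%:R * p + 1))))%:E.
Proof.
move=> p1 c0; have p0 : 0 < p by rewrite (lt_trans _ p1).
have kp0 : 0 <= k%:R * p by rewrite mulr_ge0 // ltW.
pose f m (w : R) : \bar R := ((`|w| ^+ k * (c * Psi m w)) `^ p)%:E.
pose g (w : R) : \bar R := ((c `^ p)%:E * (`|w| `^ (k%:R * p))%:E)%E.
have limE : (\int[mu]_w (g \_ `[(- pi)%R, pi]) w =
    (c `^ p * (2 * (pi `^ (k%:R * p + 1) / (k%:R * p + 1))))%:E)%E.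
  rewrite -integral_mkcond /g ge0_integralZl_EFin //.
  - by rewrite integral_norm_powR // pi_gt0.
  - apply/measurable_EFinP; apply: measurable_funTS; apply: continuous_measurable_fun.
    exact: continuous_norm_powR.
  - exact: powR_ge0.
pose D := c * (76 ^+ k + 76 ^+ k.+2) : R.
have D0 : 0 <= D by rewrite mulr_ge0 // addr_ge0 // exprn_ge0.
(* The majorant is available from this order on, so the sequence is shifted by [N]. *)
pose N := (6 * k.+2)%N.
have gt0N m : (0 < m + N)%N by rewrite addn_gt0 orbT.
have mf m : measurable_fun setT (f (m + N)%N).
  apply/measurable_EFinP; apply: (@measurableT_comp _ _ _ _ _ _ (@powR R ^~ p)) => //.
  apply: measurable_funM.
    by apply: measurable_funX; exact: normr_measurable.
  apply: measurable_funM; first exact: measurable_cst.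
  exact: measurable_scaling_modulus.
have mg : measurable_fun setT (g \_ `[(- pi)%R, pi]).
  apply/(measurable_restrictT _ _).1 => //.
  apply: measurable_funTS; apply: emeasurable_funM; first exact: measurable_cst.
  by apply/measurable_EFinP; apply: continuous_measurable_fun; exact: continuous_norm_powR.
have ih : mu.-integrable setT (fun w : R => (D `^ p)%:E * (oneDsqr w)^-1%:E)%E.
  by apply: integrableZl => //; exact: integrable_oneDsqrV.
have dom (w : R) m : (`|f (m + N)%N w| <= (D `^ p)%:E * (oneDsqr w)^-1%:E)%E.
  rewrite /f /= -EFinM lee_fin ger0_norm ?powR_ge0 //.
  have o0 : 0 < (oneDsqr w)^-1 by rewrite invr_gt0.
  apply: (@le_trans _ _ ((D * (oneDsqr w)^-1) `^ p)).
    apply: ge0_ler_powR; rewrite ?nnegrE; first exact: ltW.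
    - by rewrite !mulr_ge0 ?exprn_ge0 ?normc_ge0.
    - by rewrite mulr_ge0 // ltW.
    rewrite mulrCA /D -mulrA ler_wpM2l //.
    by apply: (scaling_modulus_dominated (gt0N m) (mH (gt0N m))); exact: leq_addl.
  have o0' := ltW o0.
  rewrite powRM // ler_wpM2l ?powR_ge0 // -[leRHS]powRr1 //.
  (* [(oneDsqr w)^-1] lies in ]0, 1], so raising it to the power [p >= 1] does not increase it. *)
  by apply: ger_powR; [rewrite o0; exact: oneDsqrV_le1|exact: ltW].
(* The null set [{- pi, pi}] is left out, where neither pointwise limit applies. *)
have ptw : {ae mu, forall w : R, setT w ->
    (f (m + N)%N w) @[m --> \oo] --> (g \_ `[(- pi)%R, pi]) w}.
  exists [set (- pi)%R; pi]; split.
  - by apply: measurableU; exact: measurable_set1.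
  - by apply: countable_lebesgue_measure0; apply: finite_set_countable; exact: finite_set2.
  - apply: subsetCl => w /= wpi _.
    have {}wpi : `|w| != pi.
      apply/negP => /eqP h; apply: wpi; rewrite -h.
      by case: (leP 0 w) => ?; [right; rewrite ger0_norm|left; rewrite ltr0_norm ?opprK].
    rewrite (cvg_shiftn N (fun m => f m w)) /f.
    have [lt|ge] := ltP `|w| pi.
      have -> : (g \_ `[(- pi)%R, pi]) w = ((`|w| ^+ k * (c * 1)) `^ p)%:E.
        rewrite patchE ifT; last by rewrite inE /= in_itv /= -ler_norml ltW.
        by rewrite /g -EFinM powRrM powR_mulrn // -powRM ?exprn_ge0 // mulr1 mulrC.
      apply: cvg_EFin; first exact: nearW.
      apply: cvg_powR => //; first by rewrite !mulr_ge0 ?exprn_ge0.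
        by move=> m; rewrite /= !mulr_ge0 ?exprn_ge0 ?normc_ge0.
      apply: cvgM; first exact: cvg_cst.
      by apply: cvgM; [exact: cvg_cst|exact: scaling_modulus_cvg1].
    have gt : pi < `|w| by rewrite lt_neqAle eq_sym wpi.
    have -> : (g \_ `[(- pi)%R, pi]) w = ((`|w| ^+ k * (c * 0)) `^ p)%:E.
      rewrite patchE ifF; first by rewrite !mulr0 powR0 ?gt_eqF.
      by apply/negP; rewrite inE /= in_itv /= -ler_norml leNgt gt.
    apply: cvg_EFin; first exact: nearW.
    apply: cvg_powR => //; first by rewrite !mulr_ge0 ?exprn_ge0.
      by move=> m; rewrite /= !mulr_ge0 ?exprn_ge0 ?normc_ge0.
    apply: cvgM; first exact: cvg_cst.
    by apply: cvgM; [exact: cvg_cst|exact: scaling_modulus_cvg0].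
have [_ _ cvgI] := @dominated_convergence _ _ R mu setT measurableT
  (fun m => f (m + N)%N) _ _ mf mg ptw ih ltac:(by apply: aeW => w m _; exact: dom).
rewrite limE in cvgI; split; last first.
  by rewrite -(cvg_shiftn N); exact: cvgI.
exists N => // m /= Nm; rewrite -(subnK Nm).
apply: integrable_fin_num => //.
apply: le_integrable ih => //; first exact: mf.
by move=> w _; rewrite (le_trans (dom w _)) // lee_abs.
Qed.

End Limit.

(** * The limit constant and the convergence of the norms *)

Lemma limit_constantE (R : realType) (p : R) (k : nat) : 0 < p ->
  ((Num.sqrt (2 * pi))^-1 `^ p * (2 * (pi `^ (k%:R * p + 1) / (k%:R * p + 1)))) `^ p^-1 =
  pi ^+ k * ((2 * pi) `^ (p^-1 - 2^-1) / (1 + p * k%:R) `^ p^-1).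
Proof.
move=> p0; have pi0 : 0 < pi :> R := pi_gt0 R.
have s0 : 0 <= (Num.sqrt (2 * pi))^-1 :> R by rewrite invr_ge0 sqrtr_ge0.
have q0 : 0 < 1 + p * k%:R by rewrite ltr_pwDl // mulr_ge0 // ltW.
have pp : p * p^-1 = 1 by rewrite mulfV ?gt_eqF.
(* One factor [pi] is split off so that [2 * pi] appears and merges with the Fourier
   normalization. *)
have -> : 2 * (pi `^ (k%:R * p + 1) / (k%:R * p + 1)) =
    2 * pi * (pi `^ (k%:R * p) * (1 + p * k%:R)^-1).
  rewrite powRD; last by rewrite (gt_eqF pi0) implybT.
  by rewrite powRr1 ?ltW // [k%:R * p]mulrC [_ + 1]addrC; ring.
have : 0 < 2 * pi :> R by rewrite mulr_gt0.
move: (2 * pi) s0 => t s0 t0.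
rewrite !powRM ?mulr_ge0 ?powR_ge0 ?invr_ge0 ?ltW //.
rewrite -!powRrM mulfK ?gt_eqF // pp powRr1 // powR_mulrn ?ltW //.
rewrite powRB; last by rewrite (gt_eqF t0) implybT.
rewrite powR12_sqrt ?ltW // -[(_ + _)^-1]powR_inv1 ?ltW // -powRrM mulN1r powRN.
by ring.
Qed.

Theorem theorem2 (R : realType) (p : R) (phi : nat -> R -> R[i]) :
  1 < p ->
  (forall m : nat, (0 < m)%N -> daubechies_scaling_function m (phi m)) ->
  forall k : nat,
    (fun m : nat => Lp_norm p (fourier_shifted (- k%:Z) (phi m))) @ \oo -->
      (pi ^+ k * ((2 * pi) `^ (p^-1 - 2^-1) / (1 + p * k%:R) `^ p^-1))%:E.
Proof.
move=> p1 dphi k; have p0 : 0 < p by rewrite (lt_trans _ p1).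
(* One mask is chosen per order; order 0 gets a dummy function. *)
have /choice [H HP] : forall m, exists Hm : R -> R[i], (0 < m)%N ->
    daubechies_mask m Hm /\ scaling_function Hm (phi m).
  move=> m; case: (posnP m) => [->|m0]; first by exists (fun=> 0).
  by have [Hm ?] := dphi m m0; exists Hm.
pose c : R := (Num.sqrt (2 * pi))^-1.
have c0 : 0 <= c by rewrite invr_ge0 sqrtr_ge0.
pose Psi m w := Normc.normc (infinite_product (fun l => H m (2 ^- l * w))).
pose I m := (\int[@lebesgue_measure R]_w ((`|w| ^+ k * (c * Psi m w)) `^ p)%:E)%E.
have [finI cvgI] : (\forall m \near \oo, I m \is a fin_num) /\ I @ \oo --> _ :=
  integral_scaling_modulus_cvg (fun m m0 => (HP m m0).1) k p1 c0.
have I0 m : (0 <= I m)%E by apply: integral_ge0 => w _; rewrite lee_fin powR_ge0.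
have normE m : (0 < m)%N ->
    Lp_norm p (fourier_shifted (- k%:Z) (phi m)) = (I m `^ p^-1)%E.
  move=> m0; have [_ [_ fE]] := HP m m0.
  rewrite /Lp_norm unlock /=; congr (_ `^ _)%E; apply: eq_integral => w _.
  rewrite ger0_norm ?normc_ge0 //; congr (_ `^ _)%:E.
  (* The exponent is [- (- k) = k], so the multiplier has modulus [|w| ^+ k]. *)
  rewrite /fourier_shifted fE opprK -exprnP !Normc.normcM; congr (_ * (_ * _)).
    have -> : `|w| = Normc.normc ('i * w%:C)%C.
      by rewrite Normc.normcM /= expr0n expr1n add0r addr0 sqrtr1 mul1r sqrtr_sqr.
    by elim: (k) => [|j IH]; rewrite ?expr0 ?Normc.normc1 // !exprS Normc.normcM IH.
  by rewrite /= expr0n addr0 sqrtr_sqr ger0_norm.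
rewrite -limit_constantE // -/c.
apply: cvg_trans (_ : (fun m => (fine (I m) `^ p^-1)%:E) @ \oo --> _).
  apply: near_eq_cvg; near=> m.
  rewrite normE; last by near: m; exact: nbhs_infty_gt.
  by rewrite -poweR_EFin fineK //; near: m.
apply: cvg_EFin; first exact: nearW.
apply: cvg_powR => //.
- by rewrite invr_gt0.
- rewrite mulr_ge0 ?powR_ge0 // mulr_ge0 // divr_ge0 ?powR_ge0 //.
  by rewrite addr_ge0 // mulr_ge0 // ltW.
- by move=> m; rewrite fine_ge0.
- exact: fine_cvg cvgI.
Unshelve. all: by end_near. Qed.
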